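(* The separated pullback defines a coherent class of subpullbacks on the category $\mathbf{Nom}$ of nominal sets, i.e. taking $A*_X B$ with its two projections as the chosen square on each cospan $A\to X\leftarrow B$ makes $\mathbf{Nom}$ a locally subcartesian category. Thus it defines an affine base change pseudofunctor $\nabla_{(-)}\colon\mathbf{Nom}^{\mathrm{op}}\to\mathbf{Cat}$, with $\nabla_f\colon\mathbf{Nom}/X\to\mathbf{Nom}/A$ given by separated pullback along $f\colon A\to X$.
   Context: Fix a countably infinite set $\mathbb{A}$ of atoms, and let $\mathrm{Perm}(\mathbb{A})$ be the group of finite permutations of $\mathbb{A}$. A nominal set is a set $X$ with an action of $\mathrm{Perm}(\mathbb{A})$ such that every $x\in X$ has a finite support, i.e. a finite $S\subseteq\mathbb{A}$ such that every $\pi\in\mathrm{Perm}(\mathbb{A})$ fixing each element of $S$ satisfies $\pi\cdot x=x$; $\mathrm{supp}(x)$ denotes the least finite support. Morphisms of $\mathbf{Nom}$ are equivariant maps. Separated pullback: for $f\colon A\to X$ and $g\colon B\to X$ in $\mathbf{Nom}$, $$A*_X B=\{(a,b)\in A\times B : f(a)=g(b)=x,\ \mathrm{supp}(a)\cap\mathrm{supp}(b)=\mathrm{supp}(x)\},$$ with componentwise action and the evident projections. A commuting square $fg'=gf'$ on a cospan $f\colon A\to X$, $g\colon B\to X$ is subcartesian if the pair $(g',f')$ is jointly monic. A locally subcartesian category is a category with, for each cospan $f\colon A\to X$, $g\colon B\to X$, a chosen subcartesian square with apex $A\otimes_X B$ and projections $g'\colon A\otimes_X B\to A$, $f'\colon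 A\otimes_X B\to B$, subject to: (symmetry) there are isomorphisms $A\otimes_X B\cong B\otimes_X A$ commuting with the projections; (nullary) if $g$ is an identity then so is $g'$ (identities are respected strictly only by convention: the chosen square is replaced by a canonically isomorphic one in this case); (binary) for $p\colon W\to Y$, $q\colon Y\to Z$, $g\colon B\to Z$, with $g'\colon Y\otimes_Z B\to Y$, pasting the chosen square of $(p,g')$ with the chosen square of $(q,g)$ gives a square isomorphic, compatibly with the projections to $W$ and $B$, to the chosen square of $(qp,g)$. *)

(* Defs.v *)
From HB Require Import structures.
From mathcomp Require Import all_boot finmap.
From mathcomp Require Import boolp classical_sets cardinality.

Set Implicit Arguments.
Unset Strict Implicit.
Unset Printing Implicit Defensive.

Local Open Scope fset_scope.

Declare Scope cat_scope.
Delimit Scope cat_scope with cat.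
Local Open Scope cat_scope.

Record category := Category {
  obj :> Type;
  hom : obj -> obj -> Type;
  idm : forall a, hom a a;
  comp : forall a b c, hom b c -> hom a b -> hom a c;
  comp_idl : forall a b (f : hom a b), comp (idm b) f = f;
  comp_idr : forall a b (f : hom a b), comp f (idm a) = f;
  comp_assoc : forall a b c d (h : hom c d) (g : hom b c) (f : hom a b),
    comp h (comp g f) = comp (comp h g) f
}.
Arguments hom {_} a b : rename.
Arguments idm {_} a : rename.
Arguments comp {_ a b c} g f : rename.

Notation "g ∘ f" := (comp g f) (at level 40, left associativity) : cat_scope.

Definition is_iso (C : category) (a b : C) (f : hom a b) : Prop :=
  exists g : hom b a, g ∘ f = idm a /\ f ∘ g = idm b.

Inductive is_identity (C : category) (a : C) : forall b : C, hom a b -> Prop :=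
  is_identity_idm : is_identity (idm a).

Definition op (C : category) : category :=
  {| obj := C;
     hom := fun a b => @hom C b a;
     idm := fun a => @idm C a;
     comp := fun _ _ _ g f => @comp C _ _ _ f g;
     comp_idl := fun _ _ f => comp_idr f;
     comp_idr := fun _ _ f => comp_idl f;
     comp_assoc := fun _ _ _ _ h g f => esym (comp_assoc f g h) |}.

Record functor (C D : category) := Functor {
  fobj :> C -> D;
  fmap : forall a b : C, hom a b -> hom (fobj a) (fobj b);
  fmap_id : forall a, fmap (idm a) = idm (fobj a);
  fmap_comp : forall a b c (g : hom b c) (f : hom a b),
    fmap (g ∘ f) = fmap g ∘ fmap f
}.
Arguments fmap {C D} F [a b] f : rename.

Definition functor_id (C : category) : functor C C :=
  @Functor C C id (fun _ _ f => f) (fun _ => erefl) (fun _ _ _ _ _ => erefl).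

Lemma functor_comp_id (C D E : category) (G : functor D E) (F : functor C D) a :
  fmap G (fmap F (idm a)) = idm (G (F a)).
Proof. by rewrite !fmap_id. Qed.

Lemma functor_comp_comp (C D E : category) (G : functor D E) (F : functor C D)
    a b c (g : hom b c) (f : hom a b) :
  fmap G (fmap F (g ∘ f)) = fmap G (fmap F g) ∘ fmap G (fmap F f).
Proof. by rewrite !fmap_comp. Qed.

Definition functor_comp (C D E : category) (G : functor D E) (F : functor C D) :
    functor C E :=
  @Functor C E (fun a => G (F a)) (fun _ _ f => fmap G (fmap F f))
    (functor_comp_id G F) (@functor_comp_comp C D E G F).

Record natural_iso (C D : category) (F G : functor C D) := NaturalIso {
  component :> forall a : C, hom (F a) (G a);
  naturality : forall (a b : C) (f : hom a b),
    fmap G f ∘ component a = component b ∘ fmap F f;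
  component_iso : forall a, is_iso (component a)
}.

(* The 2-cell [F1 f => F1 g] of [Cat] induced by an equality [f = g]; it
   mediates between the composites in [C] that the coherence laws identify. *)
Definition eq_2cell (C : category) (F0 : C -> category)
    (F1 : forall a b : C, hom a b -> functor (F0 a) (F0 b))
    (a b : C) (f g : hom a b) (e : f = g) (x : F0 a) :
    hom (F1 a b f x) (F1 a b g x) :=
  match e in _ = g' return hom (F1 a b f x) (F1 a b g' x) with
  | erefl => idm (F1 a b f x)
  end.

(* The structure making the assignments [F0] on objects and [F1] on morphisms
   a pseudofunctor [C -> Cat]. [C] is a 1-category, so there is no further
   action on 2-cells. *)
Record pseudofunctor_on (C : category) (F0 : C -> category)
    (F1 : forall a b : C, hom a b -> functor (F0 a) (F0 b)) := Pseudofunctor {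
  pf_unit : forall a : C, natural_iso (functor_id (F0 a)) (F1 a a (idm a));
  pf_comp : forall (a b c : C) (g : hom b c) (f : hom a b),
    natural_iso (functor_comp (F1 b c g) (F1 a b f)) (F1 a c (g ∘ f));
  pf_unitl : forall (a b : C) (f : hom a b) (x : F0 a),
    eq_2cell F1 (comp_idl f) x
      ∘ (pf_comp (idm b) f x ∘ pf_unit b (F1 a b f x)) = idm (F1 a b f x);
  pf_unitr : forall (a b : C) (f : hom a b) (x : F0 a),
    eq_2cell F1 (comp_idr f) x
      ∘ (pf_comp f (idm a) x ∘ fmap (F1 a b f) (pf_unit a x))
    = idm (F1 a b f x);
  pf_assoc : forall (a b c d : C) (h : hom c d) (g : hom b c) (f : hom a b)
      (x : F0 a),
    eq_2cell F1 (comp_assoc h g f) x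
      ∘ (pf_comp h (g ∘ f) x ∘ fmap (F1 c d h) (pf_comp g f x))
    = pf_comp (h ∘ g) f x ∘ pf_comp h g (F1 a b f x)
}.

Record slice_obj (C : category) (X : C) := SliceObj {
  slice_dom : C;
  slice_arr : hom slice_dom X
}.
Arguments SliceObj {C X slice_dom} slice_arr.

Record slice_hom (C : category) (X : C) (s t : slice_obj X) := SliceHom {
  slice_map :> hom (slice_dom s) (slice_dom t);
  slice_comm : slice_arr t ∘ slice_map = slice_arr s
}.

Lemma slice_hom_eq (C : category) (X : C) (s t : slice_obj X)
    (f g : slice_hom s t) : slice_map f = slice_map g -> f = g.
Proof.
case: f g => [f hf] [g hg] /= e; case: _ / e in hg *.
by rewrite (Prop_irrelevance hf hg).
Qed.

Definition slice_idm (C : category) (X : C) (s : slice_obj X) : slice_hom s s :=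
  SliceHom (comp_idr (slice_arr s)).

Lemma slice_comp_comm (C : category) (X : C) (s t u : slice_obj X)
    (g : slice_hom t u) (f : slice_hom s t) :
  slice_arr u ∘ (slice_map g ∘ slice_map f) = slice_arr s.
Proof. by rewrite comp_assoc !slice_comm. Qed.

Definition slice (C : category) (X : C) : category.
Proof.
refine {| obj := slice_obj X;
          hom := @slice_hom C X;
          idm := @slice_idm C X;
          comp := fun _ _ _ g f => SliceHom (slice_comp_comm g f) |}.
- by move=> s t f; apply: slice_hom_eq; apply: comp_idl.
- by move=> s t f; apply: slice_hom_eq; apply: comp_idr.
- by move=> s t u v h g f; apply: slice_hom_eq; apply: comp_assoc.
Defined.

(* In the square [f g' = g f'], [pr1] is [g'] and [pr2] is [f']. *)
Record square (C : category) (A B X : C) (f : hom A X) (g : hom B X) := Square {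
  apex : C;
  pr1 : hom apex A;
  pr2 : hom apex B;
  square_comm : f ∘ pr1 = g ∘ pr2
}.
Arguments Square {C A B X f g apex pr1 pr2} square_comm.

Definition subcartesian (C : category) (A B X : C) (f : hom A X) (g : hom B X)
    (s : square f g) : Prop :=
  forall (W : C) (u v : hom W (apex s)),
    pr1 s ∘ u = pr1 s ∘ v -> pr2 s ∘ u = pr2 s ∘ v -> u = v.

Definition square_iso (C : category) (A B X : C) (f : hom A X) (g : hom B X)
    (s t : square f g) : Prop :=
  exists i : hom (apex s) (apex t),
    [/\ is_iso i, pr1 t ∘ i = pr1 s & pr2 t ∘ i = pr2 s].

Definition swap (C : category) (A B X : C) (f : hom A X) (g : hom B X)
    (s : square f g) : square g f := Square (esym (square_comm s)).

Lemma paste_comm (C : category) (W Y Z B : C) (p : hom W Y) (q : hom Y Z)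
    (g : hom B Z) (s : square q g) (t : square p (pr1 s)) :
  q ∘ p ∘ pr1 t = g ∘ (pr2 s ∘ pr2 t).
Proof. by rewrite -comp_assoc square_comm !comp_assoc square_comm. Qed.

Definition paste (C : category) (W Y Z B : C) (p : hom W Y) (q : hom Y Z)
    (g : hom B Z) (s : square q g) (t : square p (pr1 s)) : square (q ∘ p) g :=
  Square (paste_comm t).

Definition square_choice (C : category) :=
  forall (A B X : C) (f : hom A X) (g : hom B X), square f g.

Record locally_subcartesian (C : category) (sq : square_choice C) : Prop := {
  ls_subcartesian : forall (A B X : C) (f : hom A X) (g : hom B X),
    subcartesian (sq A B X f g);
  ls_symmetry : forall (A B X : C) (f : hom A X) (g : hom B X),
    square_iso (sq A B X f g) (swap (sq B A X g f));
  ls_nullary : forall (A B X : C) (f : hom A X) (g : hom B X),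
    is_identity g -> is_identity (pr1 (sq A B X f g));
  ls_binary : forall (W Y Z B : C) (p : hom W Y) (q : hom Y Z) (g : hom B Z),
    square_iso
      (paste (sq W (apex (sq Y B Z q g)) Y p (pr1 (sq Y B Z q g))))
      (sq W B Z (q ∘ p) g)
}.

Lemma id_square_comm (C : category) (A X : C) (f : hom A X) :
  f ∘ idm A = idm X ∘ f.
Proof. by rewrite comp_idl comp_idr. Qed.

Definition id_square (C : category) (A X : C) (f : hom A X) :
  square f (idm X) := Square (id_square_comm f).

(* The convention on identities: the choice [sq], with its value on a cospan
   whose second leg is an identity replaced by the square [f ∘ id = id ∘ f]. *)
Definition strictify (C : category) (sq : square_choice C) : square_choice C :=
  fun A B X f g =>
    match pselect (is_identity g) with
    | left h =>
        match h in @is_identity _ _ X0 g0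
          return forall f0 : hom A X0, square f0 g0 with
        | is_identity_idm => @id_square C A B
        end f
    | right _ => sq A B X f g
    end.

Record atoms := Atoms {
  atom :> countType;
  atom_infinite : infinite_set [set: atom]
}.

Record fperm (A : atoms) := FPerm {
  fperm_fun :> A -> A;
  fperm_inv : A -> A;
  fperm_funK : cancel fperm_fun fperm_inv;
  fperm_invK : cancel fperm_inv fperm_fun;
  fperm_finite : exists S : {fset A}, forall a, a \notin S -> fperm_fun a = a
}.

HB.instance Definition _ (A : atoms) := gen_eqMixin (fperm A).
HB.instance Definition _ (A : atoms) := gen_choiceMixin (fperm A).

Section FPermGroup.
Context (A : atoms).
Implicit Types p q r : fperm A.

Lemma fpermP p q : p =1 q -> p = q.
Proof.
case: p q => [f f' fK f'K ff] [g g' gK g'K gf] /= /funext e.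
case: _ / e in gK g'K gf *.
have e : f' = g' by apply: funext => a; rewrite -[in LHS](g'K a) fK.
case: _ / e in gK g'K *.
by rewrite (Prop_irrelevance fK gK) (Prop_irrelevance f'K g'K)
           (Prop_irrelevance ff gf).
Qed.

Lemma fperm_finite1 : exists S : {fset A}, forall a, a \notin S -> id a = a.
Proof. by exists fset0. Qed.

Definition fperm1 : fperm A :=
  @FPerm A id id (fun _ => erefl) (fun _ => erefl) fperm_finite1.

Lemma fperm_finiteM p q :
  exists S : {fset A}, forall a, a \notin S -> (p \o q) a = a.
Proof.
case: (fperm_finite p) (fperm_finite q) => [S hS] [T hT].
exists (S `|` T) => a; rewrite in_fsetU negb_or => /andP[aS aT] /=.
by rewrite hT // hS.
Qed.

Definition fpermM p q : fperm A :=
  FPerm (can_comp (fperm_funK p) (fperm_funK q))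
        (can_comp (fperm_invK q) (fperm_invK p)) (fperm_finiteM p q).

Lemma fperm_finiteV p :
  exists S : {fset A}, forall a, a \notin S -> fperm_inv p a = a.
Proof.
case: (fperm_finite p) => S hS; exists S => a /hS e.
by rewrite -{1}e fperm_funK.
Qed.

Definition fpermV p : fperm A :=
  FPerm (fperm_invK p) (fperm_funK p) (fperm_finiteV p).

Lemma fpermMA : associative fpermM.
Proof. by move=> p q r; apply: fpermP. Qed.
Lemma fperm1M : left_id fperm1 fpermM.
Proof. by move=> p; apply: fpermP. Qed.
Lemma fpermM1 : right_id fperm1 fpermM.
Proof. by move=> p; apply: fpermP. Qed.
Lemma fpermVM : left_inverse fperm1 fpermV fpermM.
Proof. by move=> p; apply: fpermP => a; apply: fperm_funK. Qed.
Lemma fpermMV : right_inverse fperm1 fpermV fpermM.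
Proof. by move=> p; apply: fpermP => a; apply: fperm_invK. Qed.

End FPermGroup.

(* The product is [(p * q) a = p (q a)], as for left actions; MathComp's
   product on [{perm T}] is the opposite one. *)
HB.instance Definition _ (A : atoms) :=
  isGroup.Build (fperm A) (@fpermMA A) (@fperm1M A) (@fpermM1 A)
    (@fpermVM A) (@fpermMV A).

Lemma fpermME (A : atoms) (p q : fperm A) a : (p * q)%g a = p (q a).
Proof. by []. Qed.
Lemma fpermK (A : atoms) (p : fperm A) : cancel p (p^-1)%g.
Proof. exact: fperm_funK. Qed.
Lemma fpermKV (A : atoms) (p : fperm A) : cancel (p^-1)%g p.
Proof. exact: fperm_invK. Qed.

Section Swap.
Context (A : atoms) (a b : A).

Definition aswap_fun (c : A) : A := if c == a then b else if c == b then a else c.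

Lemma aswap_funK : involutive aswap_fun.
Proof.
move=> c; rewrite /aswap_fun; case: (eqVneq c a) => [->|ca].
  by rewrite eqxx; case: eqVneq.
by case: (eqVneq c b) => [->|cb]; rewrite ?eqxx // (negPf ca) (negPf cb).
Qed.

Lemma aswap_finite :
  exists S : {fset A}, forall c, c \notin S -> aswap_fun c = c.
Proof.
exists [fset a; b] => c; rewrite !inE negb_or => /andP[/negPf ca /negPf cb].
by rewrite /aswap_fun ca cb.
Qed.

Definition aswap : fperm A := FPerm aswap_funK aswap_funK aswap_finite.

End Swap.

Lemma fresh (A : atoms) (S : {fset A}) : exists a : A, a \notin S.
Proof.
apply: contrapT => h; apply: (@atom_infinite A); apply/finite_fsetP.
exists S; apply/seteqP; split=> a _ //=.
by apply/negPn/negP => aS; apply: h; exists a.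
Qed.

Definition fixes (A : atoms) (p : fperm A) (S : {fset A}) : Prop :=
  forall a, a \in S -> p a = a.

Definition supports (A : atoms) (X : Type) (act : fperm A -> X -> X)
    (S : {fset A}) (x : X) : Prop :=
  forall p, fixes p S -> act p x = x.

Record nominal_set (A : atoms) := NominalSet {
  carrier :> Type;
  act : fperm A -> carrier -> carrier;
  act1 : forall x, act 1%g x = x;
  actM : forall p q x, act (p * q)%g x = act p (act q x);
  act_finite_support : forall x, exists S, supports act S x
}.
Arguments act {A X} p x : rename.

Section Support.
Context (A : atoms) (X : nominal_set A).
Implicit Types (x : X) (S T : {fset A}) (p : fperm A).

Definition least_support (x : X) (S : {fset A}) : Prop :=
  supports (@act A X) S x /\
  forall T, supports (@act A X) T x -> S `<=` T.

Lemma actK p : cancel (@act A X p) (act (p^-1)%g).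
Proof. by move=> x; rewrite -actM mulVg act1. Qed.
Lemma actKV p : cancel (@act A X (p^-1)%g) (act p).
Proof. by move=> x; rewrite -actM mulgV act1. Qed.

Lemma supports_remove x S T b :
  supports act S x -> supports act T x -> b \notin S ->
  supports act (T `\ b) x.
Proof.
move=> hS hT bS p hp; have [R hR] := fperm_finite p.
have [c] := fresh (b |` S `|` T `|` R).
rewrite !inE !negb_or => /andP[/andP[/andP[cb cS] cT] cR].
pose t := aswap b c.
have tx : act t x = x.
  apply: hS => a aS /=; rewrite /aswap_fun.
  by case: eqVneq => [e|_]; [rewrite -e aS in bS | case: eqVneq => // e;
     rewrite -e aS in cS].
have : act (t^-1 * (p * t))%g x = x.
  apply: hT => a aT; rewrite !fpermME; apply: (can_inj (fpermK t)).
  rewrite fpermKV; case: (eqVneq a b) => [->|ab].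
    by rewrite /= /aswap_fun eqxx hR.
  have -> : t a = a.
    rewrite /= /aswap_fun (negPf ab); case: eqVneq => // e.
    by rewrite -e aT in cT.
  by apply: hp; rewrite !inE ab.
by rewrite !actM tx => e; rewrite -[RHS]tx -[in RHS]e actKV.
Qed.

Lemma least_support_exists x : exists S, least_support x S.
Proof.
have ex : exists n, `[< exists S, supports act S x /\ #|` S| = n >].
  by have [S hS] := act_finite_support x; exists #|` S|; apply/asboolP; exists S.
case: (ex_minnP ex) => n /asboolP[S [hS cS]] hmin; exists S; split=> // T hT.
apply/fsubsetP => a aS; apply/negPn/negP => aT.
have := hmin #|` S `\ a|; rewrite -cS (cardfsD1 a S) aS ltnn => /(_ _)/notF.
by apply; apply/asboolP; exists (S `\ a); split=> //; apply: supports_remove hT hS aT.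
Qed.

Definition supp (x : X) : {fset A} := sval (cid (least_support_exists x)).

Lemma suppP x : least_support x (supp x).
Proof. exact: (svalP (cid (least_support_exists x))). Qed.

Lemma supp_act_le p x a : a \in supp (act p x) -> (p^-1)%g a \in supp x.
Proof.
have h : supports act [fset p b | b in supp x] (act p x).
  move=> q hq; apply: (can_inj (actK p^-1)%g).
  rewrite actK -!actM; apply: (suppP x).1 => b bx.
  by rewrite !fpermME hq ?fpermK //; apply/imfsetP; exists b.
by move=> /(fsubsetP ((suppP _).2 _ h))/imfsetP[b bx ->]; rewrite fpermK.
Qed.

Lemma in_supp_act p x a : (a \in supp (act p x)) = ((p^-1)%g a \in supp x).
Proof.
apply/idP/idP => [|h]; first exact: supp_act_le.
rewrite -[x in supp x](actK p) in h.
by move/supp_act_le: h; rewrite invgK fpermKV.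
Qed.

End Support.
Arguments supp {A X} x.

Record equivariant_map (A : atoms) (X Y : nominal_set A) := EquivariantMap {
  emap :> X -> Y;
  emap_act : forall p x, emap (act p x) = act p (emap x)
}.

Lemma equivariant_map_eq (A : atoms) (X Y : nominal_set A)
    (f g : equivariant_map X Y) : f =1 g -> f = g.
Proof.
case: f g => [f hf] [g hg] /= /funext e; case: _ / e in hg *.
by rewrite (Prop_irrelevance hf hg).
Qed.

Lemma supp_emap (A : atoms) (X Y : nominal_set A) (f : equivariant_map X Y) x :
  supp (f x) `<=` supp x.
Proof.
by apply: (suppP (f x)).2 => p hp; rewrite -emap_act (suppP x).1.
Qed.

Definition equivariant_id (A : atoms) (X : nominal_set A) :
  equivariant_map X X := @EquivariantMap A X X id (fun _ _ => erefl).

Lemma equivariant_comp_act (A : atoms) (X Y Z : nominal_set A)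
    (g : equivariant_map Y Z) (f : equivariant_map X Y) p x :
  g (f (act p x)) = act p (g (f x)).
Proof. by rewrite !emap_act. Qed.

Definition Nom (A : atoms) : category.
Proof.
refine {| obj := nominal_set A;
          hom := @equivariant_map A;
          idm := @equivariant_id A;
          comp := fun _ _ _ g f => EquivariantMap (equivariant_comp_act g f) |};
  by move=> *; apply: equivariant_map_eq.
Defined.

Section SeparatedPullback.
Context (At : atoms) (A B X : Nom At) (f : hom A X) (g : hom B X).

Definition separated (ab : carrier A * carrier B) : Prop :=
  f ab.1 = g ab.2 /\ supp ab.1 `&` supp ab.2 = supp (f ab.1).

Definition sep_carrier : Type := {ab : carrier A * carrier B | separated ab}.

Lemma sep_carrier_eq (u v : sep_carrier) : sval u = sval v -> u = v.
Proof. by case: u v => [u hu] [v hv] /= e; apply: eq_exist. Qed.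

Lemma separated_act p ab : separated ab -> separated (act p ab.1, act p ab.2).
Proof.
case: ab => a b [/= e s]; split; rewrite /= !emap_act ?e //.
apply/fsetP => c; rewrite in_fsetI !in_supp_act -e -in_fsetI.
by congr (_ \in _).
Qed.

Definition sep_act (p : fperm At) (u : sep_carrier) : sep_carrier :=
  exist _ (act p (sval u).1, act p (sval u).2) (separated_act p (svalP u)).

Lemma sep_act1 u : sep_act 1%g u = u.
Proof. by apply: sep_carrier_eq; case: u => -[a b] ? /=; rewrite !act1. Qed.

Lemma sep_actM p q u : sep_act (p * q)%g u = sep_act p (sep_act q u).
Proof. by apply: sep_carrier_eq; case: u => -[a b] ? /=; rewrite !actM. Qed.

Lemma sep_finite_support u : exists S, supports sep_act S u.
Proof.
case: u => -[a b] h; exists (supp a `|` supp b) => p hp.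
apply: sep_carrier_eq; congr pair => /=.
  by apply: (suppP a).1 => c ca; apply: hp; rewrite in_fsetU ca.
by apply: (suppP b).1 => c cb; apply: hp; rewrite in_fsetU cb orbT.
Qed.

Definition sep_apex : Nom At :=
  @NominalSet At sep_carrier sep_act sep_act1 sep_actM sep_finite_support.

Definition sep_pr1 : @hom (Nom At) sep_apex A :=
  @EquivariantMap At sep_apex A (fun u => (sval u).1) (fun _ _ => erefl).

Definition sep_pr2 : @hom (Nom At) sep_apex B :=
  @EquivariantMap At sep_apex B (fun u => (sval u).2) (fun _ _ => erefl).

Lemma sep_comm : f ∘ sep_pr1 = g ∘ sep_pr2.
Proof. by apply: equivariant_map_eq => -[ab [e s]]. Qed.

End SeparatedPullback.

Definition separated_pullback (At : atoms) : square_choice (Nom At) :=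
  fun A B X f g => Square (sep_comm f g).

Section BaseChange.
Context (At : atoms) (A X : Nom At) (f : hom A X).

Definition nabla_obj (s : slice X) : slice A :=
  SliceObj (pr1 (separated_pullback f (slice_arr s))).

Section Map.
Context (s t : slice X) (h : hom s t).

Lemma nabla_separated ab :
  separated f (slice_arr s) ab ->
  separated f (slice_arr t) (ab.1, slice_map h ab.2).
Proof.
case: ab => a b [/= e i].
have ht : slice_arr t (slice_map h b) = slice_arr s b.
  by rewrite -[in RHS](slice_comm h).
split; rewrite /= ?ht //; apply/eqP; rewrite eqEfsubset; apply/andP; split.
  by rewrite -i; apply: fsetIS; apply: supp_emap.
rewrite fsubsetI supp_emap /= e -ht; exact: supp_emap.
Qed.

Definition nabla_fun (u : sep_apex f (slice_arr s)) :
    sep_apex f (slice_arr t) :=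
  exist _ ((sval u).1, slice_map h (sval u).2) (nabla_separated (svalP u)).

Lemma nabla_fun_act p u : nabla_fun (act p u) = act p (nabla_fun u).
Proof. by apply: sep_carrier_eq; rewrite /= emap_act. Qed.

Definition nabla_emap : @hom (Nom At) _ _ := EquivariantMap nabla_fun_act.

Lemma nabla_map_comm :
  slice_arr (nabla_obj t) ∘ nabla_emap = slice_arr (nabla_obj s).
Proof. exact: equivariant_map_eq. Qed.

Definition nabla_map : @hom (slice A) (nabla_obj s) (nabla_obj t) :=
  @SliceHom (Nom At) A (nabla_obj s) (nabla_obj t) nabla_emap nabla_map_comm.

End Map.

Lemma nabla_id s : nabla_map (idm s) = idm (nabla_obj s).
Proof.
apply: slice_hom_eq; apply: equivariant_map_eq => u.
by apply: sep_carrier_eq; case: u => -[].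
Qed.

Lemma nabla_comp (s t u : slice X) (k : hom t u) (h : hom s t) :
  nabla_map (k ∘ h) = nabla_map k ∘ nabla_map h.
Proof.
apply: slice_hom_eq; apply: equivariant_map_eq => v.
exact: sep_carrier_eq.
Qed.

Definition nabla : functor (slice X) (slice A) :=
  @Functor (slice X) (slice A) nabla_obj nabla_map nabla_id nabla_comp.

End BaseChange.

Definition nabla_op (At : atoms) (X A : op (Nom At)) (f : hom X A) :
  functor (@slice (Nom At) X) (@slice (Nom At) A) := @nabla At A X f.

(* The comparison isomorphisms [B ≅ X *_X B] and
   [A' *_A (A *_X B) ≅ A' *_X B] are the ones over [B]. Since the chosen
   squares are jointly monic, this determines them. *)
Definition canonical_comparisons (At : atoms)
    (P : pseudofunctor_on (@nabla_op At)) : Prop :=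
  (forall (X : Nom At) (s : slice X),
     pr2 (separated_pullback (idm X) (slice_arr s))
       ∘ slice_map (pf_unit P X s) = idm (slice_dom s)) /\
  (forall (X A A' : Nom At) (f : hom A X) (k : hom A' A) (s : slice X),
     pr2 (separated_pullback (f ∘ k) (slice_arr s))
       ∘ slice_map (@pf_comp _ _ _ P X A A' k f s)
     = pr2 (separated_pullback f (slice_arr s))
         ∘ pr2 (separated_pullback k (slice_arr (nabla f s)))).

(* Main.v *)
From mathcomp Require Import all_boot finmap.
From mathcomp Require Import boolp.
Require Import Defs.

(** Call a square on a cospan A -> X <- B of nominal sets separated when its two
    projections embed the apex into A × B with image the set of separated
    pairs. Separated squares on a given cospan are unique up to isomorphism, so
    each axiom reduces to checking that a particular square is separated. For
    pasting this rests on [supp (y, b) = supp y ∪ supp b]: a pair (w, b) over Z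
    is separated iff (p w, b) is separated over Z and (w, (p w, b)) is separated
    over Y. *)

Set Implicit Arguments.
Unset Strict Implicit.
Unset Printing Implicit Defensive.

Local Open Scope fset_scope.
Local Open Scope cat_scope.

(** * Isomorphisms of nominal sets and of slices *)

Section Isomorphisms.
Context (At : atoms).

(** An inverse picked pointwise by choice is automatically equivariant, because [f] is equivariant
    and injective. *)
Lemma nom_iso (X Y : Nom At) (f : hom X Y) :
  injective f -> (forall y, exists x, f x = y) -> is_iso f.
Proof.
move=> inj /choice[g fg].
have g_act p y : g (act p y) = act p (g y).
  by apply: inj; rewrite emap_act !fg.
exists (EquivariantMap g_act); split; apply: equivariant_map_eq => x /=.
  by apply: inj; rewrite fg.
exact: fg.
Qed.

Lemma slice_iso (C : category) (X : C) (s t : slice X) (h : hom s t) :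
  is_iso (slice_map h) -> is_iso h.
Proof.
move=> [k [kh hk]].
have k_comm : slice_arr s ∘ k = slice_arr t.
  by rewrite -(slice_comm h) -comp_assoc hk comp_idr.
by exists (SliceHom k_comm); split; apply: slice_hom_eq.
Qed.

Lemma slice_emap_comm (X : Nom At) (s t : slice X) (h : hom s t) x :
  slice_arr t (slice_map h x) = slice_arr s x.
Proof. by rewrite -[in RHS](slice_comm h). Qed.

End Isomorphisms.

(** * Separated squares: identities, symmetry, pasting, uniqueness *)

Section SeparatedSquares.
Context (At : atoms).

(** Equivariant maps do not enlarge supports, so [f a = g b] already puts [supp (f a)] inside both
    [supp a] and [supp b]; only the other inclusion is a condition. *)
Lemma separatedP (A B X : Nom At) (f : hom A X) (g : hom B X) a b :
  separated f g (a, b) <->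
  f a = g b /\ supp a `&` supp b `<=` supp (f a).
Proof.
split=> [[/= e ->]//|[e le]]; split=> //=.
apply/eqP; rewrite eqEfsubset le fsubsetI supp_emap /= e; exact: supp_emap.
Qed.

Definition separated_square (A B X : Nom At) (f : hom A X) (g : hom B X)
    (s : square f g) : Prop :=
  (forall u v : carrier (apex s),
     pr1 s u = pr1 s v -> pr2 s u = pr2 s v -> u = v) /\
  (forall a b,
     separated f g (a, b) <->
     exists u : carrier (apex s), pr1 s u = a /\ pr2 s u = b).

Lemma square_commE (A B X : Nom At) (f : hom A X) (g : hom B X)
    (s : square f g) (u : carrier (apex s)) : f (pr1 s u) = g (pr2 s u).
Proof. exact: (congr1 (fun h : hom (apex s) X => h u) (square_comm s)). Qed.

Lemma separated_square_pullback (A B X : Nom At) (f : hom A X) (g : hom B X) :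
  separated_square (separated_pullback f g).
Proof.
split=> [[[a b] h] [[a' b'] h'] /= ea eb|a b].
  by apply: sep_carrier_eq; rewrite /= ea eb.
split=> [h|[[[a' b'] h] [/= <- <-]]//].
by exists (exist _ (a, b) h).
Qed.

(** Over an identity the support condition is vacuous, so the separated pairs form the graph of
    [f]. *)
Lemma separated_square_id (A X : Nom At) (f : hom A X) :
  separated_square (id_square f).
Proof.
split=> // a x; rewrite separatedP; split=> /= [[e _]|[u [<- <-]]].
  by exists a.
by split=> //; apply: fsubsetIr.
Qed.

Lemma separated_square_swap (A B X : Nom At) (f : hom A X) (g : hom B X)
    (s : square f g) : separated_square s -> separated_square (swap s).
Proof.
move=> [inj im]; split=> [u v e1 e2|b a]; first exact: inj.
have -> : separated g f (b, a) <-> separated f g (a, b).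
  by rewrite !separatedP fsetIC; split=> -[->].
by rewrite im; split=> -[u [? ?]]; exists u.
Qed.

(** A permutation fixing both supports pointwise fixes both projections of [u], hence [u] itself by
    joint injectivity. *)
Lemma supp_apex (A B X : Nom At) (f : hom A X) (g : hom B X)
    (s : square f g) (u : carrier (apex s)) :
  separated_square s -> supp u = supp (pr1 s u) `|` supp (pr2 s u).
Proof.
move=> [inj _]; apply/eqP; rewrite eqEfsubset fsubUset !supp_emap !andbT.
apply: (suppP u).2 => p hp.
apply: inj; rewrite emap_act; apply: (suppP _).1 => c cs; apply: hp;
  by rewrite in_fsetU cs ?orbT.
Qed.

Lemma separated_square_paste (W Y Z B : Nom At) (p : hom W Y) (q : hom Y Z)
    (g : hom B Z) (s : square q g) (t : square p (pr1 s)) :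
  separated_square s -> separated_square t -> separated_square (paste t).
Proof.
move=> ss [injt imt]; have [injs ims] := ss.
split=> [u v /= e1 e2|w b].
  (* The middle component in [Y] is [p] of the component in [W], so it is determined. *)
  by apply: injt => //; apply: injs => //; rewrite -!square_commE e1.
split=> [/separatedP[/= e le]|[u [/= <- <-]]].
- have /ims[y [y1 y2]] : separated q g (p w, b).
    apply/separatedP; split=> //; apply: fsubset_trans le.
    exact/fsetSI/supp_emap.
  have /imt[u [u1 u2]] : separated p (pr1 s) (w, y).
    apply/separatedP; rewrite (supp_apex y ss) y1 y2; split=> //.
    (* With [supp y] equal to [supp (p w) ∪ supp b], the part of [supp w] meeting [supp (p w)] is
       harmless, and the part meeting [supp b] lies in [supp (q (p w))], hence in [supp (p w)]. *)
    rewrite fsetIUr fsubUset fsubsetIr /=.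
    exact/(fsubset_trans le)/supp_emap.
  by exists u; rewrite /= u1 u2.
- apply/separatedP; split=> /=; first by rewrite square_commE square_commE.
  have /separatedP[_ le1] : separated p (pr1 s) (pr1 t u, pr2 t u).
    by apply/imt; exists u.
  have /separatedP[_ le2] : separated q g (pr1 s (pr2 t u), pr2 s (pr2 t u)).
    by apply/ims; exists (pr2 t u).
  (* An atom common to [w] and [b] is also in the support of the point of [apex s], so [le1] puts it
     in [supp (p w)]; being in [supp b] too, it falls under [le2]. *)
  rewrite square_commE in le1 *; apply: fsubset_trans le2.
  rewrite fsubsetI fsubsetIr andbT; apply: fsubset_trans le1.
  exact/fsetIS/supp_emap.
Qed.

(** Both apexes embed in the product with the same image; matching points with equal projections is
    equivariant by joint injectivity. *)
Lemma separated_square_iso (A B X : Nom At) (f : hom A X) (g : hom B X)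
    (s t : square f g) :
  separated_square s -> separated_square t -> square_iso s t.
Proof.
move=> [injs ims] [injt imt].
have /choice[i hi] (u : carrier (apex s)) :
    exists v : carrier (apex t), pr1 t v = pr1 s u /\ pr2 t v = pr2 s u.
  by apply/imt/ims; exists u.
have i_act p u : i (act p u) = act p (i u).
  by apply: injt; rewrite emap_act ?(hi _).1 ?(hi _).2 emap_act.
exists (EquivariantMap i_act : @hom (Nom At) (apex s) (apex t)); split.
- apply: nom_iso => [u v /= e|v].
    by apply: injs; rewrite -?(hi _).1 -?(hi _).2 e.
  have /ims[u [u1 u2]] : separated f g (pr1 t v, pr2 t v).
    by apply/imt; exists v.
  by exists u; apply: injt => /=; rewrite ?(hi _).1 ?(hi _).2.
- by apply: equivariant_map_eq => u; apply: (hi u).1.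
- by apply: equivariant_map_eq => u; apply: (hi u).2.
Qed.

Lemma separated_square_subcartesian (A B X : Nom At) (f : hom A X)
    (g : hom B X) (s : square f g) : separated_square s -> subcartesian s.
Proof.
move=> [inj _] W u v e1 e2; apply: equivariant_map_eq => w.
apply: inj; first exact: (congr1 (fun h : hom W A => h w) e1).
exact: (congr1 (fun h : hom W B => h w) e2).
Qed.

(** The convention on identities stays within separated squares, so the results above apply to the
    strictified choice. *)
Lemma separated_square_strictify (A B X : Nom At) (f : hom A X) (g : hom B X) :
  separated_square (strictify (@separated_pullback At) f g).
Proof.
rewrite /strictify; case: pselect => [h|_].
  by case: _ _ / h in f *; apply: separated_square_id.
exact: separated_square_pullback.
Qed.

End SeparatedSquares.

Lemma strictify_nullary (C : category) (sq : square_choice C) (A B X : C)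
    (f : hom A X) (g : hom B X) :
  is_identity g -> is_identity (pr1 (strictify sq f g)).
Proof.
rewrite /strictify; case: pselect => // h _.
by case: _ _ / h in f *; apply: is_identity_idm.
Qed.

(** * Base change as a pseudofunctor, starting with the unit comparison *)

Section Pseudofunctor.
Context (At : atoms).

Section Unit.
Context (X : Nom At).

Section Component.
Context (s : slice X).

Lemma nabla_unit_separated (b : carrier (slice_dom s)) :
  separated (idm X) (slice_arr s) (slice_arr s b, b).
Proof. by apply/separatedP; split=> //=; apply: fsubsetIl. Qed.

Definition nabla_unit_fun b : sep_apex (idm X) (slice_arr s) :=
  exist _ (slice_arr s b, b) (nabla_unit_separated b).

Lemma nabla_unit_act p b : nabla_unit_fun (act p b) = act p (nabla_unit_fun b).
Proof. by apply: sep_carrier_eq; rewrite /= emap_act. Qed.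

Definition nabla_unit_emap :
    @hom (Nom At) (slice_dom s) (slice_dom (nabla (idm X) s)) :=
  EquivariantMap nabla_unit_act.

Lemma nabla_unit_comm :
  slice_arr (nabla (idm X) s) ∘ nabla_unit_emap = slice_arr s.
Proof. exact: equivariant_map_eq. Qed.

Definition nabla_unit_component : @hom (slice X) s (nabla (idm X) s) :=
  SliceHom nabla_unit_comm.

Lemma nabla_unit_iso : is_iso nabla_unit_component.
Proof.
apply/slice_iso/nom_iso => [b b' /(congr1 sval)[]//|[[x b] h]].
(* The first component of a pair over the identity is forced to be [slice_arr s b]. *)
by exists b; apply: sep_carrier_eq => /=; case: h => /= <-.
Qed.

End Component.

Lemma nabla_unit_natural (s t : slice X) (h : hom s t) :
  fmap (nabla (idm X)) h ∘ nabla_unit_component s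
  = nabla_unit_component t ∘ h.
Proof.
apply/slice_hom_eq/equivariant_map_eq => b; apply: sep_carrier_eq.
by rewrite /= slice_emap_comm.
Qed.

Definition nabla_unit : natural_iso (functor_id (slice X)) (nabla (idm X)) :=
  @NaturalIso _ _ (functor_id (slice X)) (nabla (idm X))
    nabla_unit_component nabla_unit_natural nabla_unit_iso.

End Unit.

(** * The composition comparison, read off from pasting *)

Section Composition.
Context (X A A' : Nom At) (f : hom A X) (k : hom A' A).

Section Component.
Context (s : slice X).

Let outer : square k (pr1 (separated_pullback f (slice_arr s))) :=
  separated_pullback k (slice_arr (nabla f s)).

Lemma nabla_assoc_separated (u : carrier (apex outer)) :
  separated (f ∘ k) (slice_arr s) (pr1 (paste outer) u, pr2 (paste outer) u).
Proof.
have [_ im] := separated_square_paste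
  (separated_square_pullback f (slice_arr s))
  (separated_square_pullback k (slice_arr (nabla f s))).
by apply/im; exists u.
Qed.

Definition nabla_assoc_fun (u : carrier (apex outer)) :
    sep_apex (f ∘ k) (slice_arr s) :=
  exist _ (pr1 (paste outer) u, pr2 (paste outer) u) (nabla_assoc_separated u).

Lemma nabla_assoc_act p u :
  nabla_assoc_fun (act p u) = act p (nabla_assoc_fun u).
Proof. exact: sep_carrier_eq. Qed.

Definition nabla_assoc_emap :
    @hom (Nom At) (slice_dom (nabla k (nabla f s)))
      (slice_dom (nabla (f ∘ k) s)) :=
  EquivariantMap nabla_assoc_act.

Lemma nabla_assoc_comm :
  slice_arr (nabla (f ∘ k) s) ∘ nabla_assoc_emap
  = slice_arr (nabla k (nabla f s)).
Proof. exact: equivariant_map_eq. Qed.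

Definition nabla_assoc_component :
    @hom (slice A') (nabla k (nabla f s)) (nabla (f ∘ k) s) :=
  SliceHom nabla_assoc_comm.

(** The comparison sends [(a', (a, b))] to [(a', b)]. It is bijective because the pasted square is
    separated: the forgotten [a] is [k a']. *)
Lemma nabla_assoc_iso : is_iso nabla_assoc_component.
Proof.
have [inj im] := separated_square_paste
  (separated_square_pullback f (slice_arr s))
  (separated_square_pullback k (slice_arr (nabla f s))).
apply/slice_iso/nom_iso => [u v /(congr1 sval)[e1 e2]|[[a b] h]].
  exact: inj.
have [u [u1 u2]] := (im a b).1 h.
by exists u; apply: sep_carrier_eq; rewrite /= -u1 -u2.
Qed.

End Component.

Lemma nabla_assoc_natural (s t : slice X) (h : hom s t) :
  fmap (nabla (f ∘ k)) h ∘ nabla_assoc_component s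
  = nabla_assoc_component t ∘ fmap (functor_comp (nabla k) (nabla f)) h.
Proof.
apply/slice_hom_eq/equivariant_map_eq => u; exact: sep_carrier_eq.
Qed.

Definition nabla_assoc :
    natural_iso (functor_comp (nabla k) (nabla f)) (nabla (f ∘ k)) :=
  @NaturalIso _ _ (functor_comp (nabla k) (nabla f)) (nabla (f ∘ k))
    nabla_assoc_component nabla_assoc_natural nabla_assoc_iso.

End Composition.

(** The type of underlying pairs does not depend on [f], so transport along [e] leaves the pair
    unchanged. This reduces the coherence laws to computations on pairs. *)
Lemma eq_2cell_nablaE (X A : op (Nom At)) (f g : hom X A) (e : f = g)
    (s : @slice (Nom At) X) u :
  sval (slice_map (eq_2cell (@nabla_op At) e s) u) = sval u.
Proof. by case: _ / e. Qed.

Lemma nabla_unitl (X A : op (Nom At)) (f : hom X A) (s : @slice (Nom At) X) :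
  eq_2cell (@nabla_op At) (comp_idl f) s
    ∘ (nabla_assoc f (@idm (Nom At) A) s
       ∘ @nabla_unit A (@nabla_op At X A f s))
  = idm (@nabla_op At X A f s).
Proof.
apply/slice_hom_eq/equivariant_map_eq => u; apply: sep_carrier_eq.
(* The composite is [(a, b)] to [(a, (a, b))] to [(a, b)]. *)
by rewrite [LHS]eq_2cell_nablaE; case: u => -[].
Qed.

Lemma nabla_unitr (X A : op (Nom At)) (f : hom X A) (s : @slice (Nom At) X) :
  eq_2cell (@nabla_op At) (comp_idr f) s
    ∘ (nabla_assoc (@idm (Nom At) X) f s
       ∘ fmap (@nabla_op At X A f) (@nabla_unit X s))
  = idm (@nabla_op At X A f s).
Proof.
apply/slice_hom_eq/equivariant_map_eq => u; apply: sep_carrier_eq.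
(* Here the intermediate point is [(a, (slice_arr s b, b))]. *)
by rewrite [LHS]eq_2cell_nablaE; case: u => -[].
Qed.

Lemma nabla_assocA (X A B D : op (Nom At)) (h : hom B D) (g : hom A B)
    (f : hom X A) (s : @slice (Nom At) X) :
  eq_2cell (@nabla_op At) (comp_assoc h g f) s
    ∘ (@nabla_assoc X B D (@comp (op (Nom At)) _ _ _ g f) h s
       ∘ fmap (@nabla_op At B D h) (@nabla_assoc X A B f g s))
  = @nabla_assoc X A D f (@comp (op (Nom At)) _ _ _ h g) s
    ∘ @nabla_assoc A B D g h (@nabla_op At X A f s).
Proof.
apply/slice_hom_eq/equivariant_map_eq => u; apply: sep_carrier_eq.
(* Both composites send [(d, (b, (a, x)))] to [(d, x)], through [(d, (b, x))] and [(d, (a, x))]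
   respectively. *)
by rewrite [LHS]eq_2cell_nablaE.
Qed.

Definition nabla_pseudofunctor : pseudofunctor_on (@nabla_op At) :=
  @Pseudofunctor (op (Nom At)) _ (@nabla_op At) nabla_unit
    (fun X A A' k f => @nabla_assoc X A A' f k)
    nabla_unitl nabla_unitr nabla_assocA.

End Pseudofunctor.

Theorem lemma6p0p8 (At : atoms) :
  (forall (A B X : Nom At) (f : hom A X) (g : hom B X),
     square_iso (strictify (@separated_pullback At) f g)
                (separated_pullback f g)) /\
  locally_subcartesian (strictify (@separated_pullback At)) /\
  (exists P : pseudofunctor_on (@nabla_op At), canonical_comparisons P).
Proof.
split; [|split].
- move=> A B X f g; apply: separated_square_iso.
    exact: separated_square_strictify.
  exact: separated_square_pullback.
- split=> [A B X f g|A B X f g|A B X f g|W Y Z B p q g].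
  + exact/separated_square_subcartesian/separated_square_strictify.
  + apply: separated_square_iso; first exact: separated_square_strictify.
    exact/separated_square_swap/separated_square_strictify.
  + exact: strictify_nullary.
  + apply: separated_square_iso; last exact: separated_square_strictify.
    by apply: separated_square_paste; apply: separated_square_strictify.
(* Both comparisons preserve the component in [slice_dom s] by computation. *)
- exists (nabla_pseudofunctor At); split=> *; exact: equivariant_map_eq.
Qed.
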